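(* Let $w$ be an element of a twisted Weyl group. If $w$ is convex, then for any convex subset $\mathfrak{L}\subseteq\mathfrak{R}^w_{\mathrm{st}}$ satisfying $w(\mathfrak{L})=\mathfrak{L}=-\mathfrak{L}$, both $$(\mathfrak{R}_+\setminus\mathfrak{R}^w_{\mathrm{st}},\mathfrak{L})\qquad\text{and}\qquad(\mathfrak{R}_{\mathrm{DG}(b_w^d)},\mathfrak{L})$$ for any integer $d\geq1$ are $w$-crossing pairs.
   Context: Let $\mathfrak{R}$ be a crystallographic root system with positive roots $\mathfrak{R}_+$ and Weyl group $\tilde W$, and let $\Omega$ be a group of automorphisms of $\mathfrak R$ permuting the simple roots (''twists''). $W=\Omega\ltimes\tilde W$ is called a twisted Weyl group. For $w\in W$: $\mathfrak{R}_w=\{\beta\in\mathfrak{R}_+:w(\beta)\in-\mathfrak{R}_+\}$ is the inversion set and $\ell(w)=|\mathfrak{R}_w|$; $\mathfrak{R}^w_{\mathrm{st}}$ is the set of stable roots, i.e. roots $\beta$ such that either all $w^i(\beta)$ ($i\in\mathbb Z$) are positive or all are negative. A set of roots $\mathfrak N$ is convex if $c_0\beta_0+c_1\beta_1\in\mathfrak{R}$ with $\beta_0,\beta_1\in\mathfrak N$, $c_0,c_1\in\mathbb R_{>0}$ implies $c_0\beta_0+c_1\beta_1\in\mathfrak N$. The element $w$ is convex if $\mathfrak{R}^w_{\mathrm{st}}$ is a standard parabolic subsystem. A convex subset $\mathfrak{N}\subseteq\mathfrak{R}_+\setminus\mathfrak{R}^w_{\mathrm{st}}$ is $w$-nimble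 if $\mathfrak{R}_w\subseteq\mathfrak{N}$ and $w(\mathfrak{N}\setminus\mathfrak{R}_w)\subseteq\mathfrak{N}$. Given a $w$-nimble $\mathfrak{N}$, a convex subset $\mathfrak{L}\subseteq\mathfrak{R}\setminus\mathfrak{N}$ is an $\mathfrak{N}$-leavener if $w(\mathfrak{L})=\mathfrak{L}=-\mathfrak{L}$, and both $\mathfrak{R}_w\sqcup\mathfrak{L}$ and $\mathfrak{N}\sqcup\mathfrak{L}$ are convex. Then $(\mathfrak{N},\mathfrak{L})$ is called a $w$-crossing pair. Weak left Bruhat-Chevalley order: $y\ge x$ if and only if $\ell(y)=\ell(yx^{-1})+\ell(x)$, equivalently $\mathfrak{R}_x\subseteq\mathfrak{R}_y$. The twisted braid monoid has generators $b_x$ ($x\in W$) and relations $b_xb_y=b_{xy}$ whenever $\ell(xy)=\ell(x)+\ell(y)$. For a braid $b$, the (right) Deligne-Garside factor $\mathrm{DG}(b)$ is the largest element $x$ in the weak left order such that $b=b'b_x$ for some $b'$ in the monoid; it is determined up to left multiplication by twists, which does not affect its inversion set $\mathfrak{R}_{\mathrm{DG}(b)}$. *)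

(* Defs.v *)
From HB Require Import structures.
From mathcomp Require Import all_boot all_order all_algebra all_fingroup.
From mathcomp Require Import boolp reals.
Set Implicit Arguments.
Unset Strict Implicit.
Unset Printing Implicit Defensive.
Import GRing.Theory Num.Theory.
Local Open Scope ring_scope.

Definition dot (R : realType) (n : nat) (u v : 'rV[R]_n) : R :=
  (u *m v^T) 0 0.

Definition reflection (R : realType) (n : nat) (a v : 'rV[R]_n) : 'rV[R]_n :=
  v - (2 * dot v a / dot a a) *: a.

(* Crystallographic root systems in Euclidean space R^n.  They are not assumed
   to be reduced: the reduced ones are a special case. *)
Record rootSystem (R : realType) (n : nat) := RootSystem {
  root_seq : seq 'rV[R]_n;
  root_span : <<root_seq>>%VS = fullv;
  root_neq0 : 0 \notin root_seq;
  root_reflection : forall a b : 'rV[R]_n,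
    a \in root_seq -> b \in root_seq -> reflection a b \in root_seq;
  root_integral : forall a b : 'rV[R]_n,
    a \in root_seq -> b \in root_seq -> 2 * dot b a / dot a a \is a Num.int
}.

Definition rootT (R : realType) (n : nat) (Phi : rootSystem R n) : finType :=
  seq_sub (root_seq Phi).

Definition vec (R : realType) (n : nat) (Phi : rootSystem R n)
  (b : rootT Phi) : 'rV[R]_n := ssval b.

Section RootSets.
Variables (R : realType) (n : nat) (Phi : rootSystem R n).
Implicit Types (N L J : {set rootT Phi}) (a b : rootT Phi).

Definition opp_set N : {set rootT Phi} :=
  [set b | [exists a in N, vec b == - vec a]].

Definition span_of J : {vspace 'rV[R]_n} := <<[seq vec a | a <- enum J]>>%VS.

Definition root_convex N : Prop :=
  forall (b0 b1 b : rootT Phi) (c0 c1 : R),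
    b0 \in N -> b1 \in N -> 0 < c0 -> 0 < c1 ->
    vec b = c0 *: vec b0 + c1 *: vec b1 -> b \in N.

(* The positive roots with respect to a set Delta of simple roots. *)
Definition pos (Delta : {set rootT Phi}) : {set rootT Phi} :=
  [set b | `[< exists c : rootT Phi -> nat,
               vec b = \sum_(a in Delta) vec a *+ c a >]].

Definition neg (Delta : {set rootT Phi}) : {set rootT Phi} :=
  opp_set (pos Delta).

Definition is_base (Delta : {set rootT Phi}) : Prop :=
  basis_of fullv [seq vec a | a <- enum Delta] /\
  pos Delta :|: neg Delta = [set: rootT Phi].

Definition standard_parabolic (Delta N : {set rootT Phi}) : Prop :=
  exists2 J : {set rootT Phi},
    J \subset Delta & N = [set b | vec b \in span_of J].

(* As the roots span the space, automorphisms of the root system, and in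
   particular the elements of its Weyl group, are identified with the
   permutations of the roots which they induce. *)
Definition is_automorphism (p : {perm rootT Phi}) : Prop :=
  exists2 f : {linear 'rV[R]_n -> 'rV[R]_n},
    bijective f & forall b : rootT Phi, vec (p b) = f (vec b).

Definition weyl : {group {perm rootT Phi}} :=
  <<[set p : {perm rootT Phi} |
      [exists a : rootT Phi, [forall b : rootT Phi,
        vec (p b) == reflection (vec a) (vec b)]]]>>%G.

Definition twist_group (Delta : {set rootT Phi})
    (Omega : {group {perm rootT Phi}}) : Prop :=
  forall p : {perm rootT Phi}, p \in Omega ->
    is_automorphism p /\ p @: Delta = Delta.

(* When Omega is a twist group, it normalises the Weyl group and meets it
   trivially, so that the group they generate is their (internal) semidirect
   product. *)
Definition twisted_weyl (Omega : {group {perm rootT Phi}}) :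
  {group {perm rootT Phi}} := (weyl <*> Omega)%G.

(* The product "first y, then x" of automorphisms.  The product of the group
   {perm T} composes in the opposite order: (y * x)%g b = x (y b). *)
Definition wmul (x y : {perm rootT Phi}) : {perm rootT Phi} := (y * x)%g.

Variable Delta : {set rootT Phi}.
Implicit Types w x y : {perm rootT Phi}.

Definition inv_set w : {set rootT Phi} :=
  [set b in pos Delta | w b \in neg Delta].

Definition len w : nat := #|inv_set w|.

(* The two powers below are w ^ i and w ^ (- i). *)
Definition stable w : {set rootT Phi} :=
  [set b | `[< (forall i : nat, (w ^+ i)%g b \in pos Delta /\
                                (w ^- i)%g b \in pos Delta) \/
               (forall i : nat, (w ^+ i)%g b \in neg Delta /\
                                (w ^- i)%g b \in neg Delta) >]].

Definition convex_elt w : Prop := standard_parabolic Delta (stable w).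

Definition nimble w N : Prop :=
  [/\ root_convex N,
      N \subset pos Delta :\: stable w,
      inv_set w \subset N
    & w @: (N :\: inv_set w) \subset N].

Definition leavener w N L : Prop :=
  [/\ root_convex L,
      L \subset ~: N,
      w @: L = L /\ opp_set L = L,
      root_convex (inv_set w :|: L)
    & root_convex (N :|: L)].

Definition crossing_pair w N L : Prop := nimble w N /\ leavener w N L.

(* x <= y in the weak left order. *)
Definition weak_le x y : Prop := len y = (len (wmul y x^-1%g) + len x)%N.

Variable W : {group {perm rootT Phi}}.

(* A word [:: x_1; ...; x_k] over W represents the braid b_{x_1} ... b_{x_k};
   two words represent the same element of the twisted braid monoid if and
   only if they are related by the congruence generated by the relations
   b_x b_y = b_{xy} for len (xy) = len x + len y. *)
Inductive braid_eq : seq {perm rootT Phi} -> seq {perm rootT Phi} -> Prop :=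
| BraidRel u v x y :
    x \in W -> y \in W -> len (wmul x y) = (len x + len y)%N ->
    braid_eq (u ++ [:: x; y] ++ v) (u ++ [:: wmul x y] ++ v)
| BraidRefl u : braid_eq u u
| BraidSym u v : braid_eq u v -> braid_eq v u
| BraidTrans u v t : braid_eq u v -> braid_eq v t -> braid_eq u t.

Definition right_divides x (b : seq {perm rootT Phi}) : Prop :=
  x \in W /\
  exists2 b' : seq {perm rootT Phi},
    {subset b' <= W} & braid_eq b (b' ++ [:: x]).

Definition is_DG (b : seq {perm rootT Phi}) x : Prop :=
  right_divides x b /\ forall y, right_divides y b -> weak_le y x.

(* A Deligne-Garside factor, which is unique up to left multiplication by
   elements of len 0.  The default value 1 only serves for the empty word,
   as no relation identifies the latter with b_1. *)
Definition DG (b : seq {perm rootT Phi}) : {perm rootT Phi} :=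
  odflt 1%g [pick x | `[< is_DG b x >]].

End RootSets.

(* Main.v *)
Require Import Defs.
From mathcomp Require Import all_boot all_order all_algebra all_fingroup.
From mathcomp Require Import boolp reals.
From mathcomp Require Import zify.
Set Implicit Arguments.
Unset Strict Implicit.
Unset Printing Implicit Defensive.
Import Order.TTheory GRing.Theory Num.Theory.
Local Open Scope ring_scope.

(** A combination of a positive root outside a standard parabolic subsystem
    and a root inside it is again positive and outside it: it has the same
    coordinates, up to a positive factor, on the simple roots outside the
    parabolic subsystem (nonstable_add).  Applied to the stable roots of a
    convex element w, and also to their images under w, this gives the first
    crossing pair.  It is convenient to call a set of roots saturated when it
    absorbs the addition of stable roots; a convex, saturated set of positive
    nonstable roots which contains the inversion set of w and on which w acts
    as nimbleness requires forms a crossing pair with every admissible L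
    (saturated_crossing).  It remains to see that the inversion set of
    DG(b_w^d) is such a set.

    For this the Deligne-Garside factor is computed letter by letter.  The
    basic fact is that the inversion sets contained in a convex set T of
    positive roots have a largest member (largestP).  Its proof is a diamond
    argument: an inversion set properly contained in another one can be enlarged
    inside the latter through a simple reflection (ascent), two such enlargements are
    dominated by a third one obtained from the longest element of a rank two
    parabolic subgroup (local_join), and termination turns this local
    confluence into the existence of upper bounds in T (join_in_convex).

    If z is the factor of a braid b, then the factor of b b_x is y x, where y
    is the largest element with inversion set inside that of z for which
    the product y x is length additive; this last condition says that the
    inversion set of y avoids that of x^-1, so that y is the largest element
    below a convex set.  The resulting recursion respects the relations of the
    monoid (step_wmul), hence depends on the braid only, and inv_DG identifies
    its value with DG.  In particular DG(b_w^(d+1)) = y w with y below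
    DG(b_w^d), which in turn is below DG(b_w^(d+1)); thus w maps the inversions
    of DG(b_w^(d+1)) that are not inversions of w into inversions of DG(b_w^d),
    and this is the nimbleness (garside_step).

    Saturation is preserved along the recursion.  The only delicate point is
    that the largest inversion set inside a saturated set T is saturated
    (saturated_largest): joining its element y with the longest element v of
    the stable parabolic subgroup and using the maximality of y shows that v
    preserves the inversion set of y, and a positive stable root whose addition
    might destroy an inversion of y is made negative by v. *)

(** * Roots and linear permutations *)

Section Roots.
Variables (R : realType) (n : nat) (Phi : rootSystem R n).
Implicit Types (a b c : rootT Phi) (p q : {perm rootT Phi}).

Lemma vec_inj : injective (@vec R n Phi).
Proof. exact: val_inj. Qed.

Lemma vec_in b : vec b \in root_seq Phi.
Proof. exact: valP. Qed.

Lemma vec_neq0 b : vec b != 0.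
Proof.
by apply/eqP => b0; have := vec_in b; rewrite b0; apply/negP/root_neq0.
Qed.

Lemma dotE (u v : 'rV[R]_n) : dot u v = \sum_i u 0 i * v 0 i.
Proof. by rewrite /dot mxE; apply: eq_bigr => i _; rewrite mxE. Qed.

(** The form is positive definite, being the standard scalar product. *)
Lemma dot_neq0 (u : 'rV[R]_n) : u != 0 -> dot u u != 0.
Proof.
apply: contraNneq => /eqP; rewrite dotE psumr_eq0 => [/allP u0|i _]; last first.
  by rewrite -expr2 sqr_ge0.
apply/eqP/rowP => i; rewrite mxE; apply/eqP.
by have := u0 i (mem_index_enum i); rewrite /= mulf_eq0 orbb.
Qed.

(** Matrices act on the right on row vectors; with this the linearity of a
    permutation of the roots can be expressed by a matrix. *)
Definition refl_mx (u : 'rV[R]_n) : 'M[R]_n :=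
  1%:M - (2 / dot u u) *: (u^T *m u).

Lemma refl_mxE (u v : 'rV[R]_n) : reflection u v = v *m refl_mx u.
Proof.
rewrite /reflection /refl_mx mulmxBr mulmx1 -scalemxAr mulmxA.
rewrite [v *m u^T]mx11_scalar mul_scalar_mx scalerA -/(dot v u).
by rewrite mulrAC.
Qed.

Lemma reflection_self (u : 'rV[R]_n) : u != 0 -> reflection u u = - u.
Proof.
move=> /dot_neq0 u0.
by rewrite /reflection mulfK // scaler_nat mulr2n opprD addNKr.
Qed.

Lemma reflectionK (u : 'rV[R]_n) : u != 0 -> involutive (reflection u).
Proof.
move=> u0 v; rewrite {2}/reflection refl_mxE mulmxBl -scalemxAl -!refl_mxE.
by rewrite reflection_self // scalerN opprK /reflection subrK.
Qed.

Definition refl_fun a b : rootT Phi :=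
  SeqSub (root_reflection (vec_in a) (vec_in b)).

Lemma refl_fun_inj a : injective (refl_fun a).
Proof.
move=> b b' /(congr1 (@vec R n Phi)) e; apply: vec_inj.
exact: (inv_inj (reflectionK (vec_neq0 a))) e.
Qed.

Definition root_refl a : {perm rootT Phi} := perm (@refl_fun_inj a).

Lemma vec_root_refl a b : vec (root_refl a b) = reflection (vec a) (vec b).
Proof. by rewrite permE. Qed.

(** The reflection in a root sends it to its opposite. *)
Definition root_opp b : rootT Phi := root_refl b b.

Lemma vec_opp b : vec (root_opp b) = - vec b.
Proof. by rewrite vec_root_refl reflection_self // vec_neq0. Qed.

Lemma root_oppK : involutive root_opp.
Proof. by move=> b; apply: vec_inj; rewrite !vec_opp opprK. Qed.

Lemma mem_opp_set (N : {set rootT Phi}) b :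
  (b \in opp_set N) = (root_opp b \in N).
Proof.
rewrite inE; apply/exists_inP/idP => [[a aN /eqP e]|bN].
  suff -> : root_opp b = a by [].
  by apply: vec_inj; rewrite vec_opp e opprK.
by exists (root_opp b) => //; rewrite vec_opp opprK.
Qed.

Definition linear_perm p : Prop :=
  exists M : 'M[R]_n, forall b, vec (p b) = vec b *m M.

Lemma linear_perm_opp p b : linear_perm p -> p (root_opp b) = root_opp (p b).
Proof. by case=> M pM; apply: vec_inj; rewrite vec_opp !pM vec_opp mulNmx. Qed.

Lemma linear_perm_comb p b b0 b1 (c0 c1 : R) : linear_perm p ->
  vec b = c0 *: vec b0 + c1 *: vec b1 ->
  vec (p b) = c0 *: vec (p b0) + c1 *: vec (p b1).
Proof.
by case=> M pM e; rewrite !pM e mulmxDl -!scalemxAl.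
Qed.

Lemma linear_perm_gen (A : {set {perm rootT Phi}}) :
  (forall p, p \in A -> linear_perm p) ->
  forall p, p \in <<A>>%g -> linear_perm p.
Proof.
move=> linA p /gen_prodgP[m [f fA ->]].
elim/big_ind: _ => [|q r [M qM] [N rN]|i _]; last exact: linA.
  by exists 1%:M => b; rewrite perm1 mulmx1.
by exists (M *m N) => b; rewrite permM rN qM mulmxA.
Qed.

Lemma linear_perm_inv p : linear_perm p -> linear_perm p^-1.
Proof.
move=> lp; have : (p^-1)%g \in <<[set p]>>%g by rewrite groupV mem_gen ?set11.
by apply: linear_perm_gen => _ /set1P->.
Qed.

Lemma root_refl_linear a : linear_perm (root_refl a).
Proof. by exists (refl_mx (vec a)) => b; rewrite vec_root_refl refl_mxE. Qed.

Lemma root_refl_weyl a : root_refl a \in weyl Phi.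
Proof.
apply: mem_gen; rewrite inE; apply/existsP; exists a; apply/forallP => b.
by rewrite vec_root_refl.
Qed.

Lemma twisted_weyl_linear (Delta : {set rootT Phi})
    (Omega : {group {perm rootT Phi}}) p :
  twist_group Delta Omega -> p \in twisted_weyl Omega -> linear_perm p.
Proof.
move=> hO; apply: linear_perm_gen => {}p /setUP[]; last first.
  by case/hO=> -[f _ pf] _; exists (lin1_mx f) => b; rewrite pf mul_rV_lin1.
apply: linear_perm_gen => {}p; rewrite inE => /existsP[a /forallP ap].
by exists (refl_mx (vec a)) => b; rewrite (eqP (ap b)) refl_mxE.
Qed.

(** * Coordinates on the simple roots, positivity *)

Variable Delta : {set rootT Phi}.
Hypothesis hD : is_base Delta.

Definition simple_root (i : 'I_#|Delta|) : rootT Phi := enum_val i.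

(* The simple roots in the order of their enumeration, as a basis. *)
Let X := map_tuple (@vec R n Phi) (enum_tuple Delta).
Definition scoord (i : 'I_#|Delta|) (v : 'rV[R]_n) : R := coord X i v.

Lemma simple_nth (i : 'I_#|Delta|) : X`_i = vec (simple_root i).
Proof.
rewrite /simple_root (enum_val_nth (enum_val i)).
by rewrite -[RHS](nth_map _ 0 (@vec R n Phi)) // -cardE.
Qed.

Lemma scoordD i u v : scoord i (u + v) = scoord i u + scoord i v.
Proof. exact: linearD. Qed.
Lemma scoordZ i k v : scoord i (k *: v) = k * scoord i v.
Proof. exact: linearZ. Qed.
Lemma scoordN i v : scoord i (- v) = - scoord i v.
Proof. exact: linearN. Qed.
Lemma scoord_sum i (I : Type) (r : seq I) (P : pred I) (F : I -> 'rV[R]_n) :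
  scoord i (\sum_(k <- r | P k) F k) = \sum_(k <- r | P k) scoord i (F k).
Proof. exact: linear_sum. Qed.

Lemma scoord_simple i j : scoord i (vec (simple_root j)) = (i == j)%:R.
Proof.
have Xfree : free X by case: hD => /andP[].
by rewrite -simple_nth /scoord coord_free // eq_sym.
Qed.

Lemma scoord_expand v : v = \sum_i scoord i v *: vec (simple_root i).
Proof.
have Xb : basis_of fullv X by case: hD.
rewrite {1}(coord_basis Xb (memvf v)).
by apply: eq_bigr => i _; rewrite simple_nth.
Qed.

Lemma simpleP a : a \in Delta -> exists i, a = simple_root i.
Proof.
by move=> aD; exists (enum_rank_in aD a); rewrite /simple_root enum_rankK_in.
Qed.

Lemma simple_in i : simple_root i \in Delta.
Proof. exact: enum_valP. Qed.

Lemma pos_scoord i b : b \in pos Delta -> 0 <= scoord i (vec b).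
Proof.
rewrite inE => /asboolP[c ->]; rewrite scoord_sum; apply: sumr_ge0 => a.
case/simpleP=> j ->; rewrite -scaler_nat scoordZ scoord_simple.
by rewrite mulr_ge0 ?ler0n.
Qed.

Lemma pos_opp b : (root_opp b \in pos Delta) = (b \notin pos Delta).
Proof.
have [bP|bN] := boolP (b \in pos Delta); last first.
  have : b \in pos Delta :|: neg Delta by case: hD => _ ->; rewrite inE.
  by rewrite inE (negPf bN) /= mem_opp_set.
apply/negP => bP'; have /eqP[] := vec_neq0 b.
rewrite (scoord_expand (vec b)) big1 // => i _.
suff -> : scoord i (vec b) = 0 by rewrite scale0r.
apply/eqP; rewrite eq_le pos_scoord // andbT.
by have := pos_scoord i bP'; rewrite vec_opp scoordN oppr_ge0.
Qed.

Lemma neg_pos b : (b \in neg Delta) = (b \notin pos Delta).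
Proof. by rewrite mem_opp_set pos_opp. Qed.

(** A root with nonnegative coordinates cannot be negative, as it would then
    have only zero coordinates. *)
Lemma posE b : reflect (forall i, 0 <= scoord i (vec b)) (b \in pos Delta).
Proof.
apply: (iffP idP) => [bP i|bge]; first exact: pos_scoord.
apply: contraT; rewrite -pos_opp => bP'; have /eqP[] := vec_neq0 b.
rewrite (scoord_expand (vec b)) big1 // => i _.
suff -> : scoord i (vec b) = 0 by rewrite scale0r.
apply/eqP; rewrite eq_le bge andbT.
by have := pos_scoord i bP'; rewrite vec_opp scoordN oppr_ge0.
Qed.

(** One positive coordinate suffices, because the coordinates of a root are all
    nonnegative or all nonpositive. *)
Lemma pos_gt0 i b : 0 < scoord i (vec b) -> b \in pos Delta.
Proof.
move=> bi; apply: contraT; rewrite -pos_opp => /(pos_scoord i).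
by rewrite vec_opp scoordN oppr_ge0 leNgt bi.
Qed.

Lemma simple_pos a : a \in Delta -> a \in pos Delta.
Proof.
by case/simpleP=> i ->; apply: (@pos_gt0 i); rewrite scoord_simple eqxx.
Qed.

Lemma pos_convex : root_convex (pos Delta).
Proof.
move=> b0 b1 b c0 c1 /posE p0 /posE p1 c00 c10 e.
by apply/posE => i; rewrite e scoordD !scoordZ addr_ge0 // mulr_ge0 // ltW.
Qed.

Lemma nonpos_convex : root_convex (~: pos Delta).
Proof.
move=> b0 b1 b c0 c1; rewrite !in_setC -!pos_opp => p0 p1 c00 c10 e.
apply: (pos_convex p0 p1 c00 c10).
by rewrite !vec_opp !scalerN -opprD e.
Qed.

(** Vanishing coefficients are harmless: a positive multiple c b is also the
    combination (c/2) b + (c/2) b. *)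
Lemma convex_ge0 (T : {set rootT Phi}) b0 b1 b (c0 c1 : R) :
  root_convex T -> b0 \in T -> b1 \in T -> 0 <= c0 -> 0 <= c1 ->
  vec b = c0 *: vec b0 + c1 *: vec b1 -> b \in T.
Proof.
move=> cT; wlog : b0 b1 c0 c1 / c0 <= c1 => [H|].
  have [le01|/ltW le10] := leP c0 c1; first exact: H.
  by move=> b0T b1T c00 c10 e; apply: (H b1 b0 c1 c0) => //; rewrite addrC.
move=> le01 b0T b1T; rewrite le_eqVlt => /predU1P[<-|c00] c10 e; last first.
  exact: (cT b0 b1 b c0 c1) (lt_le_trans c00 le01) e.
move: c10; rewrite le_eqVlt => /predU1P[c10|c10].
  by have := vec_neq0 b; rewrite e -c10 !scale0r addr0 eqxx.
apply: (cT b1 b1 b (c1 / 2) (c1 / 2)); rewrite ?divr_gt0 //.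
by rewrite e scale0r add0r -scalerDl -splitr.
Qed.

Lemma span_scoord (J : {set rootT Phi}) v : J \subset Delta ->
  reflect (forall i, simple_root i \notin J -> scoord i v = 0)
          (v \in span_of J).
Proof.
move=> JD; apply: (iffP idP) => [vJ i iJ|v0].
  rewrite /span_of in vJ.
  rewrite (coord_span (X := map_tuple (@vec R n Phi) (enum_tuple J)) vJ).
  rewrite scoord_sum big1 // => k _; rewrite scoordZ.
  have kJ : enum_val k \in J by exact: enum_valP.
  have [j ej] := simpleP (subsetP JD _ kJ).
  rewrite [_`_k](nth_map (enum_val k) 0) -?cardE //.
  rewrite -(enum_val_nth (enum_val k)) ej scoord_simple.
  case: eqP => [eij|_]; last by rewrite mulr0.
  by move: iJ; rewrite eij -ej kJ.
rewrite (scoord_expand v); apply: memv_suml => i _.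
have [iJ|/v0->] := boolP (simple_root i \in J); last by rewrite scale0r mem0v.
by apply/memvZ/memv_span/map_f; rewrite mem_enum.
Qed.

Lemma nonspan_scoord (J : {set rootT Phi}) b : J \subset Delta ->
  vec b \notin span_of J -> b \in pos Delta ->
  exists2 i, simple_root i \notin J & 0 < scoord i (vec b).
Proof.
move=> JD bJ bP; apply: contrapT => noi; move/negP: bJ; apply.
apply/(span_scoord _ JD) => i iJ; apply: contrapT => /eqP bi.
by apply: noi; exists i; rewrite // lt_neqAle eq_sym bi pos_scoord.
Qed.

Lemma inv_setE p b :
  (b \in inv_set Delta p) = (b \in pos Delta) && (p b \notin pos Delta).
Proof. by rewrite inE neg_pos. Qed.

Lemma inv_set1 : inv_set Delta 1%g = set0.
Proof. by apply/setP => b; rewrite inv_setE perm1 in_set0 andbN. Qed.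

Lemma inv_set_convex p : linear_perm p -> root_convex (inv_set Delta p).
Proof.
move=> lp b0 b1 b c0 c1; rewrite !inv_setE.
move=> /andP[p0 n0] /andP[p1 n1] c00 c10 e.
rewrite (pos_convex p0 p1 c00 c10 e) /=.
have:= nonpos_convex _ _ c00 c10 (linear_perm_comb lp e).
by rewrite !in_setC; apply.
Qed.

(** * Length additive products *)

(** Stated by inclusion of inversion sets, in the form in which it is used;
    len_reduced shows that it amounts to additivity of the length. *)
Definition reduced p q : bool :=
  inv_set Delta q \subset inv_set Delta (wmul p q).

Lemma wmulE p q b : wmul p q b = p (q b).
Proof. exact: permM. Qed.

Lemma reducedP p q : linear_perm p -> linear_perm q ->
  reflect (forall c, c \in inv_set Delta p -> (q^-1)%g c \in pos Delta)
          (reduced p q).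
Proof.
move=> lp lq; have lq' := linear_perm_inv lq.
apply: (iffP subsetP) => [red c|H b].
  rewrite inv_setE => /andP[cP pcN]; apply: contraT; rewrite -pos_opp => oP.
  have := red (root_opp ((q^-1)%g c)).
  rewrite !inv_setE oP /= wmulE !linear_perm_opp // permKV pos_opp cP.
  by move/(_ isT); rewrite pos_opp (negPf pcN).
rewrite !inv_setE => /andP[bP qbN]; rewrite bP wmulE; apply/negP => pqb.
have := H (root_opp (q b)); rewrite inv_setE pos_opp qbN /=.
rewrite !linear_perm_opp // pos_opp pqb => /(_ isT).
by rewrite permK pos_opp bP.
Qed.

(** The product p q inverts b if q does, or else if p inverts q b. *)
Lemma inv_set_reduced p q b : linear_perm p -> linear_perm q -> reduced p q ->
  (b \in inv_set Delta (wmul p q)) =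
  (b \in inv_set Delta q) || (q b \in inv_set Delta p).
Proof.
move=> lp lq red; have [bq|] := boolP (b \in inv_set Delta q).
  by rewrite (subsetP red).
rewrite /= !inv_setE wmulE negb_and negbK.
have [bP /= ->//|/= bN _] := boolP (b \in pos Delta).
apply/esym/negP => qb.
move/(reducedP lp lq): red => /(_ (q b)); rewrite inv_setE permK => /(_ qb).
by rewrite (negPf bN).
Qed.

(** In general the inversions of p are, on the one hand, the images under q of
    the inversions C of p q which are not inversions of q and, on the other
    hand, the opposites of the images of the inversions B of q which p turns
    back into positive roots.  Hence the lengths add up exactly when B is
    empty. *)
Lemma len_reduced p q : linear_perm p -> linear_perm q ->
  (len Delta (wmul p q) == len Delta p + len Delta q)%N = reduced p q.
Proof.
move=> lp lq; have lq' := linear_perm_inv lq.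
set B := inv_set Delta q :\: inv_set Delta (wmul p q).
set C := inv_set Delta (wmul p q) :\: inv_set Delta q.
have eB : #|(fun b => root_opp (q b)) @: B| = #|B|.
  by apply: card_imset => b b' /(inv_inj root_oppK)/perm_inj.
have eC : #|q @: C| = #|C| by apply: card_imset; exact: perm_inj.
have ep : inv_set Delta p = q @: C :|: (fun b => root_opp (q b)) @: B.
  apply/setP => c; apply/idP/setUP => [|[]/imsetP[b]]; last first.
  - rewrite in_setD !inv_setE wmulE => /andP[+ /andP[bP qb]] ->.
    rewrite bP /= negbK => pqb.
    by rewrite linear_perm_opp // !pos_opp negbK qb pqb.
  - rewrite in_setD !inv_setE wmulE => /andP[+ /andP[bP pqb]] ->.
    by rewrite bP /= pqb andbT negbK.
  rewrite inv_setE => /andP[cP pc].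
  have [bP|bN] := boolP ((q^-1)%g c \in pos Delta); [left|right].
    apply/imsetP; exists ((q^-1)%g c); last by rewrite permKV.
    by rewrite in_setD !inv_setE wmulE permKV bP cP pc.
  apply/imsetP; exists (root_opp ((q^-1)%g c)); last first.
    by rewrite linear_perm_opp // permKV root_oppK.
  rewrite in_setD !inv_setE wmulE !linear_perm_opp // permKV !pos_opp bN cP.
  by rewrite /= (negPf pc).
have dis : #|inv_set Delta p| = (#|C| + #|B|)%N.
  rewrite ep cardsU eB eC [_ :&: _](_ : _ = set0) ?cards0 ?subn0 //.
  apply/setP => c; rewrite in_set0; apply/negP => /setIP[/imsetP[b bC ->]].
  case/imsetP => b' b'B e; move: bC b'B; rewrite !in_setD !inv_setE.
  move=> /and3P[_ bP _] /and3P[_ b'P _].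
  move: e; rewrite -linear_perm_opp // => /perm_inj e.
  by move: bP; rewrite e pos_opp b'P.
have -> : reduced p q = (#|B| == 0)%N by rewrite cards_eq0 setD_eq0.
rewrite /len dis.
rewrite -(cardsID (inv_set Delta q) (inv_set Delta (wmul p q))) -/C.
rewrite -(cardsID (inv_set Delta (wmul p q)) (inv_set Delta q)) -/B setIC.
by move: #|_ :&: _| #|B| #|C| => k x y; apply/eqP/eqP; lia.
Qed.

End Roots.

(** * Joins in the weak order *)

Section WeakOrder.
Variables (R : realType) (n : nat) (Phi : rootSystem R n).
Variables (Delta : {set rootT Phi}) (hD : is_base Delta).
Variable W : {group {perm rootT Phi}}.
Hypothesis Wlin : forall p, p \in W -> linear_perm p.
Hypothesis Wrefl : forall a : rootT Phi, root_refl a \in W.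
Implicit Types (a b c : rootT Phi) (p q v z m : {perm rootT Phi}).
Implicit Types (J T : {set rootT Phi}).

Local Notation pos := (pos Delta).
Local Notation inv := (inv_set Delta).

Lemma wmul_in p q : p \in W -> q \in W -> wmul p q \in W.
Proof. by move=> pW qW; rewrite groupM. Qed.

Lemma wmulKV p q : wmul (wmul p q^-1) q = p.
Proof. by rewrite /wmul mulKVg. Qed.

Lemma wmulA p q z : wmul p (wmul q z) = wmul (wmul p q) z.
Proof. by rewrite /wmul mulgA. Qed.

Definition refl_group J : {group {perm rootT Phi}} :=
  <<[set root_refl a | a in J]>>%G.

Lemma refl_group_W J p : p \in refl_group J -> p \in W.
Proof.
apply: subsetP; rewrite gen_subG; apply/subsetP => _ /imsetP[a _ ->].
exact: Wrefl.
Qed.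

(** Each reflection in a root of J changes a root by a multiple of a root
    of J. *)
Lemma refl_group_sub J p b : p \in refl_group J ->
  vec (p b) - vec b \in span_of J.
Proof.
case/gen_prodgP => m [f fJ ->] {p}.
elim/big_ind: _ b => [b|p q pJ qJ b|i _ b].
- by rewrite perm1 subrr mem0v.
- rewrite permM -(subrK (vec (p b)) (vec (q _))) -addrA memvD //.
- have /imsetP[a aJ ->] := fJ i.
  rewrite vec_root_refl /reflection addrAC subrr add0r -scaleNr.
  by apply/memvZ/memv_span/map_f; rewrite mem_enum.
Qed.

Lemma refl_group_span J p b : p \in refl_group J ->
  (vec (p b) \in span_of J) = (vec b \in span_of J).
Proof.
move=> /(refl_group_sub b) pb.
by rewrite -{1}(subrK (vec b) (vec (p b))) rpredDl.
Qed.

(** The coordinates outside J are left unchanged by the group, and one of them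
    is positive. *)
Lemma refl_group_pos J p b : J \subset Delta -> p \in refl_group J ->
  vec b \notin span_of J -> b \in pos -> p b \in pos.
Proof.
move=> JD pG bJ bP.
have [i iJ bi] := nonspan_scoord hD JD bJ bP.
apply: (@pos_gt0 _ _ _ _ hD i).
rewrite -(subrK (vec b) (vec (p b))) scoordD.
rewrite (elimT (span_scoord hD _ JD) _ _ iJ).
  by rewrite add0r.
exact: refl_group_sub.
Qed.

(** An element v of maximal length in the parabolic subgroup: if v a were
    positive for some a in J then the product of v with the reflection in a
    would be longer.  So v makes all of J negative, hence also all positive
    roots spanned by J. *)
Lemma longest_in_parabolic J : J \subset Delta ->
  exists2 v, v \in refl_group J &
    forall b, (b \in inv v) = (b \in pos) && (vec b \in span_of J).
Proof.
move=> JD.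
have [v vG vmax] : exists2 v, v \in refl_group J &
    forall p, p \in refl_group J -> (len Delta p <= len Delta v)%N.
  case: (@arg_maxnP _ 1%g (mem (refl_group J)) (len Delta)) => [|v vG vmax].
    exact: group1.
  by exists v.
exists v => // b; have lv := Wlin (refl_group_W vG).
have vJ a : a \in J -> v a \notin pos.
  move=> aJ; apply/negP => va; have aP := simple_pos hD (subsetP JD _ aJ).
  have sG : root_refl a \in refl_group J by apply/mem_gen/imset_f.
  have ls := root_refl_linear a.
  have sa : root_refl a a = root_opp a by [].
  suff : reduced Delta v (root_refl a).
    rewrite -(len_reduced hD lv ls) => /eqP e; have := vmax _ (groupM sG vG).
    rewrite -/(wmul _ _) e -[leqRHS]addn0 leq_add2l leqn0 cards_eq0.
    by apply/negP/set0Pn; exists a; rewrite inv_setE // aP sa pos_opp // aP.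
  apply/subsetP => c; rewrite !inv_setE // => /andP[cP sc]; rewrite cP wmulE.
  have [i ai] := simpleP (subsetP JD _ aJ).
  have aD : [set a] \subset Delta by rewrite sub1set (subsetP JD).
  (* The reflection in a only inverts the positive multiples of a. *)
  have c_a : vec c = scoord i (vec c) *: vec a + 0 *: vec a.
    have ca : vec c \in span_of [set a].
      apply: contraNT sc => ca; apply: (@refl_group_pos [set a]) => //.
      by apply/mem_gen/imset_f; rewrite set11.
    rewrite [LHS](scoord_expand hD) (bigD1 i) //= ai scale0r.
    rewrite big1 ?addr0 // => j ji.
    rewrite (elimT (span_scoord hD _ aD) ca) ?scale0r // in_set1 ai.
    by apply: contraNneq ji => /enum_val_inj->.
  have := linear_perm_comb lv (linear_perm_comb ls c_a).
  rewrite -in_setC => e.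
  apply: (convex_ge0 (nonpos_convex hD) _ _ _ _ e); rewrite ?pos_scoord //.
    by rewrite sa linear_perm_opp // in_setC pos_opp // va.
  by rewrite sa linear_perm_opp // in_setC pos_opp // va.
rewrite inv_setE //; have [bP /=|//] := boolP (b \in pos).
have [bJ|bJ] := boolP (vec b \in span_of J); last first.
  by rewrite (refl_group_pos JD vG bJ bP).
rewrite -pos_opp //; apply/(posE hD) => j; rewrite vec_opp scoordN oppr_ge0.
have [M vM] := lv.
rewrite vM {1}(scoord_expand hD (vec b)) mulmx_suml scoord_sum.
apply: sumr_le0 => i _; rewrite -scalemxAl -vM scoordZ.
have [iJ|iJ] := boolP (simple_root i \in J); last first.
  by rewrite (elimT (span_scoord hD _ JD) bJ _ iJ) mul0r.
rewrite mulr_ge0_le0 ?pos_scoord //.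
have := vJ _ iJ; rewrite -pos_opp // => /(pos_scoord hD j).
by rewrite vec_opp scoordN oppr_ge0.
Qed.

(** The witness is u z, where u is the longest element of the parabolic
    subgroup of a1 and a2: its inversions which are not inversions of z are
    the images under z^-1 of the nonnegative combinations of a1 and a2.  The
    case a1 = a2 is the upward step of z along one simple reflection. *)
Lemma local_join z a1 a2 : z \in W -> a1 \in Delta -> a2 \in Delta ->
  (z^-1)%g a1 \in pos -> (z^-1)%g a2 \in pos ->
  exists m, [/\ m \in W, inv z \subset inv m,
    (z^-1)%g a1 \in inv m, (z^-1)%g a2 \in inv m &
    forall T, root_convex T -> inv z \subset T -> (z^-1)%g a1 \in T ->
      (z^-1)%g a2 \in T -> inv m \subset T].
Proof.
move=> zW a1D a2D za1 za2; set J := [set a1; a2].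
have JD : J \subset Delta by rewrite subUset !sub1set a1D.
have [u uG invu] := longest_in_parabolic JD.
have uW := refl_group_W uG; have lu := Wlin uW; have lz := Wlin zW.
have lz' := linear_perm_inv lz.
have comb c : c \in inv u -> exists c1 c2 : R,
    [/\ 0 <= c1, 0 <= c2 & vec c = c1 *: vec a1 + c2 *: vec a2].
  rewrite invu => /andP[cP cJ].
  have [i1 e1] := simpleP a1D; have [i2 e2] := simpleP a2D.
  have zero i : i != i1 -> i != i2 -> scoord i (vec c) = 0.
    move=> ii1 ii2; apply: (elimT (span_scoord hD _ JD) cJ); rewrite !inE e1 e2.
    by rewrite negb_or !(inj_eq enum_val_inj) ii1.
  have [e12|ne] := eqVneq i1 i2.
    exists (scoord i1 (vec c)), 0; split; rewrite ?pos_scoord //.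
    rewrite [LHS](scoord_expand hD) (bigD1 i1) //= e1 scale0r big1 // => i ii1.
    by rewrite zero ?scale0r -?e12.
  exists (scoord i1 (vec c)), (scoord i2 (vec c)).
  split; rewrite ?pos_scoord //.
  rewrite [LHS](scoord_expand hD) (bigD1 i1) //= (bigD1 i2) 1?eq_sym //=.
  rewrite e1 e2 big1.
    by rewrite addr0.
  by move=> i /andP[ii1 ii2]; rewrite zero ?scale0r.
have closed T c : root_convex T -> (z^-1)%g a1 \in T -> (z^-1)%g a2 \in T ->
    c \in inv u -> (z^-1)%g c \in T.
  move=> cT a1T a2T /comb[c1 [c2 [c10 c20 e]]].
  exact: (convex_ge0 cT a1T a2T c10 c20 (linear_perm_comb lz' e)).
have red : reduced Delta u z.
  by apply/reducedP => // c; apply: closed => //; exact: pos_convex.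
have inu a : a \in J -> (z^-1)%g a \in pos -> (z^-1)%g a \in inv (wmul u z).
  move=> aJ za; rewrite inv_set_reduced // permKV invu simple_pos //=.
    by rewrite memv_span ?orbT // map_f // mem_enum.
  exact: (subsetP JD).
exists (wmul u z); split.
- exact: wmul_in.
- exact: red.
- by apply: inu; rewrite ?set21.
- by apply: inu; rewrite ?set22.
move=> T cT zT a1T a2T; apply/subsetP => b.
rewrite inv_set_reduced // => /orP[/(subsetP zT)//|/closed].
by rewrite permK; apply.
Qed.

(** Otherwise v z^-1 maps all simple roots, hence all positive roots, to
    positive roots, and then z inverts everything that v inverts. *)
Lemma ascent z v : z \in W -> v \in W -> inv z \subset inv v ->
  ~~ (inv v \subset inv z) -> exists2 a, a \in Delta & (z^-1)%g a \in inv v.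
Proof.
move=> zW vW zv nvz; apply: contrapT => noa; move/negP: nvz; apply.
have lq : linear_perm (wmul v z^-1) by apply: Wlin; rewrite wmul_in ?groupV.
have lz := Wlin zW; have lv := Wlin vW; have lz' := linear_perm_inv lz.
have qD a : a \in Delta -> wmul v z^-1 a \in pos.
  move=> aD; apply/negPn/negP; rewrite wmulE => va; apply: noa; exists a => //.
  rewrite inv_setE // va andbT -[_ \in _]negbK -pos_opp //; apply/negP => oP.
  have : root_opp ((z^-1)%g a) \in inv z.
    by rewrite inv_setE // oP linear_perm_opp // permKV pos_opp // simple_pos.
  move/(subsetP zv); rewrite inv_setE // oP linear_perm_opp // pos_opp // va.
  by [].
have qP c : c \in pos -> wmul v z^-1 c \in pos.
  move=> cP; apply/(posE hD) => j; have [M qM] := lq.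
  rewrite qM {1}(scoord_expand hD (vec c)) mulmx_suml scoord_sum.
  apply: sumr_ge0 => i _; rewrite -scalemxAl -qM scoordZ.
  rewrite mulr_ge0 ?pos_scoord //.
  by rewrite qD ?simple_in.
apply/subsetP => b; rewrite !inv_setE // => /andP[bP vb]; rewrite bP /=.
by apply: contra vb => /qP; rewrite wmulE permK.
Qed.

(** Newman's diamond argument, by induction on the number of roots of T which
    are not inversions of a common lower bound z.  The first steps za and zb
    from z towards the two elements have the common upper bound zab; za lies
    below x and zab, zb below y and zab, and zab below the two upper bounds so
    obtained. *)
Lemma join_in_convex T v1 v2 : root_convex T -> T \subset pos ->
  v1 \in W -> v2 \in W -> inv v1 \subset T -> inv v2 \subset T ->
  exists m, [/\ m \in W, inv v1 \subset inv m, inv v2 \subset inv m &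
    inv m \subset T].
Proof.
move=> cT Tpos v1W v2W v1T v2T.
suff H k z x y : (#|T| - len Delta z < k)%N -> z \in W -> x \in W -> y \in W ->
    inv z \subset inv x -> inv z \subset inv y ->
    inv x \subset T -> inv y \subset T ->
    exists m, [/\ m \in W, inv x \subset inv m, inv y \subset inv m &
      inv m \subset T].
  apply: (H _ 1%g _ _ (ltnSn _)); rewrite ?group1 ?inv_set1 ?sub0set //.
elim: k z x y => // k IHk z x y zk zW xW yW zx zy xT yT.
have [xz|nxz] := boolP (inv x \subset inv z).
  by exists y; rewrite yW subxx yT (subset_trans xz zy).
have [yz|nyz] := boolP (inv y \subset inv z).
  by exists x; rewrite xW subxx xT (subset_trans yz zx).
have [a aD ax] := ascent zW xW zx nxz.
have [b bD by_] := ascent zW yW zy nyz.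
have aP : (z^-1)%g a \in pos by move: ax; rewrite inv_setE // => /andP[].
have bP : (z^-1)%g b \in pos by move: by_; rewrite inv_setE // => /andP[].
have [za [zaW zza aza _ zamin]] := local_join zW aD aD aP aP.
have [zb [zbW zzb bzb _ zbmin]] := local_join zW bD bD bP bP.
have [zab [zabW zzab azab bzab zabmin]] := local_join zW aD bD aP bP.
have zabT : inv zab \subset T.
  apply: zabmin => //; first exact: subset_trans zx xT.
    exact: (subsetP xT).
  exact: (subsetP yT).
have za_x : inv za \subset inv x.
  by apply: zamin => //; exact/inv_set_convex/Wlin.
have zb_y : inv zb \subset inv y.
  by apply: zbmin => //; exact/inv_set_convex/Wlin.
have za_ab : inv za \subset inv zab.
  by apply: zamin => //; exact/inv_set_convex/Wlin.
have zb_ab : inv zb \subset inv zab.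
  by apply: zbmin => //; exact/inv_set_convex/Wlin.
have dec v c : c \in Delta -> inv z \subset inv v -> (z^-1)%g c \in inv v ->
    inv v \subset T -> (#|T| - len Delta v < k)%N.
  move=> cD zv cv vT.
  have : (len Delta z < len Delta v)%N.
    apply/proper_card; rewrite properE zv; apply/subsetPn.
    exists ((z^-1)%g c) => //.
    by rewrite inv_setE // permKV (simple_pos hD cD) andbF.
  have vleT : (len Delta v <= #|T|)%N := subset_leq_card vT.
  move: zk vleT; move: (len Delta z) (len Delta v) #|T| => lz lv t.
  by clear; lia.
have [m1 [m1W xm1 abm1 m1T]] : exists m, [/\ m \in W, inv x \subset inv m,
    inv zab \subset inv m & inv m \subset T].
  by apply: (IHk za) => //; apply: (dec _ a) => //; exact: subset_trans za_x xT.
have [m2 [m2W ym2 abm2 m2T]] : exists m, [/\ m \in W, inv y \subset inv m,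
    inv zab \subset inv m & inv m \subset T].
  by apply: (IHk zb) => //; apply: (dec _ b) => //; exact: subset_trans zb_y yT.
have [m [mW m1m m2m mT]] : exists m, [/\ m \in W, inv m1 \subset inv m,
    inv m2 \subset inv m & inv m \subset T].
  by apply: (IHk zab) => //; exact: (dec _ a).
exists m; split=> //; first exact: subset_trans xm1 m1m.
exact: subset_trans ym2 m2m.
Qed.

(** When T is convex and consists of positive roots, an element of maximal
    length is the largest one, by join_in_convex.  The default value 1 always
    qualifies, its inversion set being empty. *)
Definition largest T : {perm rootT Phi} :=
  [arg max_(m > 1%g | (m \in W) && (inv m \subset T)) len Delta m].

Lemma largestP T : root_convex T -> T \subset pos ->
  [/\ largest T \in W, inv (largest T) \subset T &
    forall y, y \in W -> inv y \subset T -> inv y \subset inv (largest T)].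
Proof.
move=> cT Tpos; rewrite /largest; case: arg_maxnP => [|m /andP[mW mT] mmax].
  by rewrite group1 inv_set1 // sub0set.
split=> // y yW yT.
have [x [xW mx yx xT]] := join_in_convex cT Tpos mW yW mT yT.
suff /eqP -> : inv m == inv x by [].
by rewrite eqEcard mx; apply: mmax; rewrite xW.
Qed.

(** * The Deligne-Garside factor, letter by letter *)

(** A positive root is not inverted by x^-1 when its image under x^-1 is
    positive. *)
Lemma avoid_convex z x : z \in W -> x \in W ->
  root_convex (inv z :\: inv x^-1%g).
Proof.
move=> zW xW b0 b1 b c0 c1; rewrite !in_setD => /andP[x0 z0] /andP[x1 z1].
move=> c00 c10 e; rewrite (inv_set_convex hD (Wlin zW) z0 z1 c00 c10 e) andbT.
have xpos c : c \in inv z -> c \notin inv x^-1%g -> (x^-1)%g c \in pos.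
  by rewrite !inv_setE // => /andP[-> _]; rewrite negbK.
have lx' := linear_perm_inv (Wlin xW).
rewrite inv_setE // negb_and negbK; apply/orP; right.
apply: (pos_convex hD _ _ c00 c10 (linear_perm_comb lx' e)); exact: xpos.
Qed.

Lemma avoid_pos z x : inv z :\: inv x^-1%g \subset pos.
Proof.
by apply/subsetP => b; rewrite in_setD !inv_setE // => /and3P[].
Qed.

Lemma reduced_avoid y x : y \in W -> x \in W ->
  reduced Delta y x = [disjoint inv y & inv x^-1%g].
Proof.
move=> yW xW; rewrite disjoint_subset.
apply/(reducedP hD (Wlin yW) (Wlin xW))/subsetP => H c cy.
  by rewrite inE inv_setE // H // andbF.
have := H c cy; rewrite inE inv_setE // negb_and negbK => /orP[|//].
by move: cy; rewrite inv_setE // => /andP[->].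
Qed.

(** The factor of b b_x when z is the factor of b: see reduced_avoid for the
    set of roots which occurs here. *)
Definition step z x : {perm rootT Phi} :=
  wmul (largest (inv z :\: inv x^-1%g)) x.

Lemma stepP z x : z \in W -> x \in W ->
  exists y, [/\ y = largest (inv z :\: inv x^-1%g), y \in W,
    step z x = wmul y x, inv y \subset inv z & reduced Delta y x].
Proof.
move=> zW xW; exists (largest (inv z :\: inv x^-1%g)).
have [yW yT _] := largestP (avoid_convex zW xW) (avoid_pos z x).
move: (yT); rewrite subsetD => /andP[yz dis].
by split=> //; rewrite reduced_avoid.
Qed.

Lemma step_in z x : z \in W -> x \in W -> step z x \in W.
Proof.
by move=> zW xW; have [y [_ yW -> _ _]] := stepP zW xW; rewrite wmul_in.
Qed.

Lemma reduced_wmul_sub y y' x : y \in W -> y' \in W -> x \in W ->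
  reduced Delta y x -> reduced Delta y' x ->
  (inv (wmul y x) \subset inv (wmul y' x)) = (inv y \subset inv y').
Proof.
move=> yW y'W xW red red'; have lx := Wlin xW.
have ly := Wlin yW; have ly' := Wlin y'W.
apply/subsetP/subsetP => sub b; last first.
  rewrite !inv_set_reduced // => /orP[->//|/sub->]; exact: orbT.
move=> yb; have := sub ((x^-1)%g b); rewrite !inv_set_reduced // permKV yb orbT.
move=> /(_ isT) /orP[|//]; rewrite inv_setE // permKV => /andP[_].
by move: yb; rewrite inv_setE // => /andP[->].
Qed.

Lemma step_max z x y : z \in W -> x \in W -> y \in W ->
  reduced Delta y x -> inv y \subset inv z ->
  inv (wmul y x) \subset inv (step z x).
Proof.
move=> zW xW yW red yz; have [m [em mW -> mz redm]] := stepP zW xW.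
rewrite reduced_wmul_sub // em.
have [_ _] := largestP (avoid_convex zW xW) (avoid_pos z x); apply=> //.
by rewrite subsetD yz -reduced_avoid.
Qed.

Lemma step_ge z x : z \in W -> x \in W -> inv x \subset inv (step z x).
Proof. by move=> zW xW; have [y [_ _ -> _ ]] := stepP zW xW. Qed.

Lemma step_mono z z' x : z \in W -> z' \in W -> x \in W ->
  inv z \subset inv z' -> inv (step z x) \subset inv (step z' x).
Proof.
move=> zW z'W xW zz'; have [y [_ yW -> yz red]] := stepP zW xW.
exact: step_max (subset_trans yz zz').
Qed.

Lemma reduced_left x y z : x \in W -> y \in W -> z \in W ->
  reduced Delta x (wmul y z) -> reduced Delta y z -> reduced Delta x y.
Proof.
move=> xW yW zW rx ry; have lx := Wlin xW; have ly := Wlin yW.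
have lz := Wlin zW; have lyz : linear_perm (wmul y z) := Wlin (wmul_in yW zW).
apply/reducedP => // c cx; move/(reducedP hD lx lyz): rx => /(_ c cx) rx.
apply: contraT; rewrite -pos_opp // => oP.
have : root_opp ((y^-1)%g c) \in inv y.
  rewrite inv_setE // oP linear_perm_opp // permKV pos_opp // negbK.
  by move: cx; rewrite inv_setE // => /andP[].
move/(reducedP hD ly lz): ry => ry /ry; have lz' := linear_perm_inv lz.
by rewrite linear_perm_opp // pos_opp // -permM -invMg rx.
Qed.

(** The inclusions translate the fact that, when y z is length additive, so are
    the two ways of bracketing x y z or neither. *)
Lemma reduced_assoc x y z :
  x \in W -> y \in W -> z \in W -> reduced Delta y z ->
  reduced Delta x (wmul y z) =
  reduced Delta x y && reduced Delta (wmul x y) z.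
Proof.
move=> xW yW zW ry; apply/idP/andP => [rx|[rx]].
  split; first exact: reduced_left rx ry.
  by apply: subset_trans ry _; rewrite -wmulA.
move=> rxyz; rewrite /reduced wmulA; apply/subsetP => b.
have lx := Wlin xW; have ly := Wlin yW; have lz := Wlin zW.
have lxy : linear_perm (wmul x y) := Wlin (wmul_in xW yW).
rewrite !inv_set_reduced // => /orP[->//|zb].
by rewrite zb orbT.
Qed.

(** Both sides are the largest element of the form q x y, with q below z and
    q x y length additive: on the left, a factor u of the second step lies
    above x, because x y is length additive, and so has the form t x with t
    below z. *)
Lemma step_wmul z x y : z \in W -> x \in W -> y \in W -> reduced Delta x y ->
  inv (step (step z x) y) = inv (step z (wmul x y)).
Proof.
move=> zW xW yW rxy; have xyW := wmul_in xW yW; have sW := step_in zW xW.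
apply/eqP; rewrite eqEsubset; apply/andP; split.
  have [u [eu uW -> uz ru]] := stepP sW yW.
  have [q [_ qW eq_ qz rq]] := stepP zW xW.
  have xu : inv x \subset inv u.
    have [_ _] := largestP (avoid_convex sW yW) (avoid_pos (step z x) y).
    rewrite -eu; apply=> //.
    by rewrite subsetD step_ge // -reduced_avoid.
  set t := wmul u x^-1; have tW : t \in W by rewrite wmul_in ?groupV.
  have ut : u = wmul t x by rewrite /t wmulKV.
  have rt : reduced Delta t x by rewrite /reduced -ut.
  rewrite ut -wmulA; apply: step_max => //.
    by rewrite reduced_assoc // rt -ut.
  apply: subset_trans qz.
  by rewrite -(@reduced_wmul_sub t q x) // -ut -eq_.
have [u [_ uW -> uz]] := stepP zW xyW.
rewrite reduced_assoc // wmulA => /andP[rux ruxy].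
apply: step_max => //; [exact: wmul_in | exact: step_max].
Qed.

Definition garside : seq {perm rootT Phi} -> {perm rootT Phi} :=
  foldl step 1%g.

Local Notation inW := (all (fun p : {perm rootT Phi} => p \in W)).

Lemma foldl_step_in z u : z \in W -> inW u -> foldl step z u \in W.
Proof.
by elim: u z => //= x u IHu z zW /andP[xW uW]; rewrite IHu ?step_in.
Qed.

Lemma garside_in u : inW u -> garside u \in W.
Proof. exact/foldl_step_in/group1. Qed.

(** For the empty word this is the hypothesis; otherwise even the elements
    agree, as step only refers to the inversion set of its first argument. *)
Lemma foldl_step_ext z z' u :
  inv z = inv z' -> inv (foldl step z u) = inv (foldl step z' u).
Proof. by case: u => //= x u e; rewrite /step e. Qed.

Lemma garside_rcons u x : garside (u ++ [:: x]) = step (garside u) x.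
Proof. by rewrite /garside foldl_cat. Qed.

(** The relations only replace letters of W by letters of W, so that they do
    not leave the words over W. *)
Lemma braid_eq_garside (u v : seq {perm rootT Phi}) : braid_eq Delta W u v ->
  inW u = inW v /\ (inW u -> inv (garside u) = inv (garside v)).
Proof.
elim=> {u v} [u v x y xW yW /eqP|u|u v _ [e H]|u v t _ [e1 H1] _ [e2 H2]] //.
- rewrite len_reduced; try exact: Wlin; last by [].
  move=> rxy; rewrite !all_cat /= xW yW wmul_in //; split=> //.
  case/andP=> uW vW; rewrite /garside !foldl_cat /=.
  by apply: foldl_step_ext; rewrite step_wmul ?foldl_step_in.
- by rewrite e; split=> // vW; rewrite H ?e.
- by rewrite e1 e2; split=> // vW; rewrite H1 ?e1 ?e2 // H2 ?e2.
Qed.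

Lemma braid_eq_cat (u v t : seq {perm rootT Phi}) :
  braid_eq Delta W u v -> braid_eq Delta W (u ++ t) (v ++ t).
Proof.
elim=> {u v} [u v x y xW yW e|u|u v _|u v s _ IH1 _ IH2].
- by rewrite -!catA; apply: BraidRel.
- exact: BraidRefl.
- exact: BraidSym.
- exact: BraidTrans IH1 IH2.
Qed.

(** If z divides u and y is below z, then b_z = b_(z y^-1) b_y, and b_y b_x =
    b_(y x).  The word consisting of x alone has to be treated apart, since the
    empty word is not divisible by 1: here y has length 0 and
    b_x = b_(y^-1) b_(y x). *)
Lemma garside_divides u : u != [::] -> inW u ->
  right_divides Delta W (garside u) u.
Proof.
elim/last_ind: u => // u x IHu _.
rewrite -cats1 all_cat /= andbT => /andP[uW xW].
split; first by rewrite garside_in // all_cat uW /= xW.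
rewrite garside_rcons.
have [y [_ yW -> yz red]] := stepP (garside_in uW) xW.
have [u0|u0] := eqVneq u [::].
  have inv_y : inv y = set0.
    by apply/eqP; rewrite -subset0 -(inv_set1 hD); rewrite u0 in yz.
  exists [:: y^-1%g] => [q|]; first by rewrite inE => /eqP->; rewrite groupV.
  have yxK : wmul y^-1 (wmul y x) = x by rewrite /wmul mulgK.
  apply: BraidSym; rewrite u0 /= -{2}yxK.
  apply: (@BraidRel _ _ _ _ _ [::] [::]); rewrite ?wmul_in ?groupV //.
  have lx := Wlin xW; have ly := Wlin yW; have ly' := linear_perm_inv ly.
  have lyx : linear_perm (wmul y x) by apply: Wlin; exact: wmul_in.
  apply/eqP; rewrite len_reduced // /reduced yxK; apply/subsetP => c.
  by rewrite inv_set_reduced // inv_y in_set0 orbF.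
have [zW [b bW ub]] := IHu u0 uW.
set z := garside u in zW ub yz.
exists (b ++ [:: wmul z y^-1]).
  move=> q; rewrite mem_cat inE => /orP[/bW//|/eqP->].
  by rewrite wmul_in ?groupV.
apply: BraidTrans (braid_eq_cat _ ub) _.
have zyW : wmul z y^-1 \in W by rewrite wmul_in ?groupV.
have redz : reduced Delta (wmul z y^-1) y by rewrite /reduced wmulKV.
have lx := Wlin xW; have ly := Wlin yW; have lzy := Wlin zyW.
apply: (@BraidTrans _ _ _ _ _ _ (b ++ [:: wmul z y^-1; y; x])).
  rewrite -!catA; apply: BraidSym.
  rewrite -{2}(wmulKV z y); apply: (@BraidRel _ _ _ _ _ b [:: x]) => //.
  by apply/eqP; rewrite len_reduced.
rewrite -!catA.
have := @BraidRel _ _ _ Delta W (b ++ [:: wmul z y^-1]) [::] y x yW xW.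
by rewrite -!catA; apply; apply/eqP; rewrite len_reduced.
Qed.

Lemma garside_nseqS d w : garside (nseq d.+1 w) = step (garside (nseq d w)) w.
Proof. by rewrite -garside_rcons -addn1 nseqD. Qed.

Lemma garside_nseq_in d w : w \in W -> garside (nseq d w) \in W.
Proof. by move=> wW; apply/garside_in/allP => p /nseqP[->]. Qed.

(** The factor of b_w^d divides b_w^(d+1) = b_w b_w^d; in terms of the
    recursion, this is the monotonicity of step. *)
Lemma garside_nseq_mono d w : w \in W ->
  inv (garside (nseq d w)) \subset inv (garside (nseq d.+1 w)).
Proof.
move=> wW; elim: d => [|d IHd]; first by rewrite /= inv_set1 // sub0set.
by rewrite !(garside_nseqS _ w) step_mono -?garside_nseqS ?garside_nseq_in.
Qed.

Lemma right_divides_garside u y : inW u -> right_divides Delta W y u ->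
  inv y \subset inv (garside u).
Proof.
move=> uW [yW [b bW /braid_eq_garside[_ /(_ uW)->]]].
by rewrite garside_rcons step_ge // garside_in //; apply/allP.
Qed.

Lemma weak_leE x y : x \in W -> y \in W ->
  weak_le Delta x y <-> inv x \subset inv y.
Proof.
move=> xW yW.
have lt : linear_perm (wmul y x^-1) by apply: Wlin; rewrite wmul_in ?groupV.
have := len_reduced hD lt (Wlin xW); rewrite /reduced wmulKV => <-.
by split=> [->|/eqP].
Qed.

Lemma inv_DG u : u != [::] -> inW u -> inv (DG Delta W u) = inv (garside u).
Proof.
move=> u0 uW.
have gu : is_DG Delta W u (garside u).
  split=> [|y yu]; first exact: garside_divides.
  by apply/weak_leE; rewrite ?garside_in ?right_divides_garside //; case: yu.
rewrite /DG; case: pickP => [x /asboolP[xu xmax]|/(_ (garside u))]; last first.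
  by move/asboolP.
apply/eqP; rewrite eqEsubset right_divides_garside //=.
by apply/weak_leE; rewrite ?garside_in //; [case: xu | apply/xmax; case: gu].
Qed.

(** * Convex elements and saturated sets *)

Section Convex.
Variables (J : {set rootT Phi}) (w : {perm rootT Phi}).
Hypotheses (JD : J \subset Delta) (wW : w \in W).
Let st : {set rootT Phi} := [set b | vec b \in span_of J].
Hypothesis w_st : forall b, (w b \in st) = (b \in st).
Hypothesis w_pos : forall b, b \in st -> (w b \in pos) = (b \in pos).

Lemma in_st b : (b \in st) = (vec b \in span_of J).
Proof. by rewrite inE. Qed.

Lemma st_opp b : (root_opp b \in st) = (b \in st).
Proof. by rewrite !in_st vec_opp memvN. Qed.

(** On a simple root outside J the coordinate of b is c0 times that of b0. *)
Lemma nonstable_add b0 b1 b (c0 c1 : R) : b0 \in pos :\: st -> b1 \in st ->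
  0 < c0 -> vec b = c0 *: vec b0 + c1 *: vec b1 -> b \in pos :\: st.
Proof.
rewrite !in_setD !in_st => /andP[b0J b0P] b1J c00 e.
have [i iJ b0i] := nonspan_scoord hD JD b0J b0P.
have gt0 : 0 < scoord i (vec b).
  rewrite e scoordD !scoordZ (elimT (span_scoord hD _ JD) b1J) // mulr0 addr0.
  exact: mulr_gt0.
rewrite (pos_gt0 hD gt0) andbT; apply/negP => bJ.
by rewrite (elimT (span_scoord hD _ JD) bJ) // ltxx in gt0.
Qed.

Lemma nonstable_convex : root_convex (pos :\: st).
Proof.
move=> b0 b1 b c0 c1; rewrite !in_setD !in_st.
move=> /andP[b0J b0P] /andP[b1J b1P] c00 c10 e.
have [i iJ b0i] := nonspan_scoord hD JD b0J b0P.
have gt0 : 0 < scoord i (vec b).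
  rewrite e scoordD !scoordZ; apply: ltr_pwDl; first exact: mulr_gt0.
  by rewrite mulr_ge0 ?pos_scoord // ltW.
rewrite (pos_gt0 hD gt0) andbT; apply/negP => bJ.
by rewrite (elimT (span_scoord hD _ JD) bJ) // ltxx in gt0.
Qed.

Lemma inv_nonstable : inv w \subset pos :\: st.
Proof.
apply/subsetP => b; rewrite inv_setE // in_setD => /andP[bP wb].
by rewrite bP andbT; apply: contra wb => /w_pos->.
Qed.

Lemma w_nonstable b : b \in pos :\: st -> b \notin inv w -> w b \in pos :\: st.
Proof.
rewrite !in_setD w_st inv_setE // => /andP[-> ->] /=.
by rewrite negbK.
Qed.

(** The case of a negative coefficient is included, stable roots being closed
    under opposites. *)
Definition saturated (S : {set rootT Phi}) : Prop :=
  forall b0 b1 b (c0 c1 : R), b0 \in S -> b1 \in st -> 0 < c0 -> 0 < c1 ->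
    vec b = c0 *: vec b0 + c1 *: vec b1 -> b \in S.

Lemma saturated_nonstable : saturated (pos :\: st).
Proof. by move=> b0 b1 b c0 c1 b0N b1J c00 _; exact: nonstable_add. Qed.

(** Add stable roots both to an inversion b0 and to the positive nonstable root
    opposite to w b0. *)
Lemma saturated_inv : saturated (inv w).
Proof.
move=> b0 b1 b c0 c1 b0N b1J c00 c10 e; have lw := Wlin wW.
have b0n := subsetP inv_nonstable _ b0N.
have := nonstable_add b0n b1J c00 e; rewrite in_setD => /andP[_ bP].
rewrite inv_setE // bP /= -pos_opp //.
suff : root_opp (w b) \in pos :\: st by rewrite in_setD => /andP[].
apply: (@nonstable_add (root_opp (w b0)) (root_opp (w b1)) _ c0 c1) => //.
- move: b0N b0n; rewrite in_setD inv_setE // => /andP[_ wb0] /andP[b0J _].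
  by rewrite in_setD pos_opp // wb0 st_opp w_st b0J.
- by rewrite st_opp w_st.
- by rewrite !vec_opp !scalerN -opprD -(linear_perm_comb lw e).
Qed.

(** A reflection in a root of J adds a multiple of a stable root. *)
Lemma refl_saturated T p b : saturated T -> p \in refl_group J ->
  b \in T -> p b \in T.
Proof.
move=> satT /gen_prodgP[m [f fJ ->]] {p}.
elim/big_ind: _ b => [b|p q pT qT b bT|i _ b bT].
- by rewrite perm1.
- by rewrite permM qT ?pT.
have /imsetP[a aJ ->] := fJ i.
have aS : a \in st by rewrite inE memv_span // map_f // mem_enum.
set k := 2 * dot (vec b) (vec a) / dot (vec a) (vec a).
have e : vec (root_refl a b) = vec b - k *: vec a by rewrite vec_root_refl.
have [k0|k0|k0] := ltrgtP k 0.
- apply: (satT b a _ 1 (- k)); rewrite ?oppr_gt0 //.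
  by rewrite scale1r scaleNr.
- apply: (satT b (root_opp a) _ 1 k); rewrite ?st_opp //.
  by rewrite scale1r vec_opp scalerN.
- suff -> : root_refl a b = b by [].
  by apply: vec_inj; rewrite e k0 scale0r subr0.
Qed.

(** Let y be the largest element below T and v the longest element of the
    parabolic subgroup of J.  Since T together with the positive stable roots is
    convex, y and v have an upper bound m = m' v with inversions in this union.
    Then the inversions of m' lie in T, so m' is below y by maximality, while
    v maps the inversions of y to inversions of m'.  Thus v preserves the
    inversion set of y.  If now b is a combination of an inversion b0 of y and
    a stable root b1, either y b1 is negative, and b is visibly inverted, or
    b1 is positive, v b1 is a negative stable root, and the same argument
    applies to v b, v b0 and v b1. *)
Lemma saturated_largest T : root_convex T -> T \subset pos :\: st ->
  saturated T -> saturated (inv (largest T)).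
Proof.
move=> cT Tn satT.
have Tpos : T \subset pos by apply: subset_trans Tn (subsetDl _ _).
have [yW yT ymax] := largestP cT Tpos.
set y := largest T in yW yT ymax *; have ly := Wlin yW.
have [v vG invv] := longest_in_parabolic JD.
have vW := refl_group_W vG; have lv := Wlin vW.
have v_st b : (v b \in st) = (b \in st) by rewrite !inE refl_group_span.
have inv_v b : (b \in inv v) = (b \in pos) && (b \in st).
  by rewrite invv [b \in st]inE.
have inv_v_st : inv v \subset st.
  by apply/subsetP => b; rewrite inv_v => /andP[].
have T_st b : b \in T -> b \notin st.
  by move/(subsetP Tn); rewrite in_setD => /andP[].
have cTv : root_convex (T :|: inv v).
  move=> b0 b1 b c0 c1 /setUP[b0T|b0v] /setUP[b1T|b1v] c00 c10 e; apply/setUP.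
  - by left; apply: (cT b0 b1 b c0 c1).
  - by left; apply: (satT b0 b1 b c0 c1) => //; exact: (subsetP inv_v_st).
  - left; apply: (satT b1 b0 b c1 c0) => //; first exact: (subsetP inv_v_st).
    by rewrite addrC.
  - by right; exact: (inv_set_convex hD lv b0v b1v c00 c10 e).
have Tvpos : T :|: inv v \subset pos.
  by rewrite subUset Tpos; apply/subsetP => b; rewrite inv_v => /andP[].
have [m [mW ym vm mTv]] : exists m, [/\ m \in W, inv y \subset inv m,
    inv v \subset inv m & inv m \subset T :|: inv v].
  apply: join_in_convex => //; last exact: subsetUr.
  exact: subset_trans yT (subsetUl _ _).
set m' := wmul m v^-1; have m'W : m' \in W by rewrite wmul_in ?groupV.
have em : m = wmul m' v by rewrite wmulKV.
have lm' := Wlin m'W.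
have red : reduced Delta m' v by rewrite /reduced -em.
have inv_m b : (b \in inv m) = (b \in inv v) || (v b \in inv m').
  by rewrite em inv_set_reduced.
have m'T : inv m' \subset T.
  apply/subsetP => c cm'; rewrite -(permKV v c); apply: refl_saturated => //.
  have : (v^-1)%g c \in T :|: inv v.
    by apply: (subsetP mTv); rewrite inv_m permKV cm' orbT.
  case/setUP=> // cv; move: cv cm'.
  by rewrite !inv_setE // permKV => /andP[_ /negPf->].
have vy b : b \in inv y -> v b \in inv y.
  move=> yb; apply: (subsetP (ymax _ m'W m'T)).
  have := subsetP ym _ yb; rewrite inv_m => /orP[|//].
  by move/(subsetP inv_v_st); rewrite (negPf (T_st _ (subsetP yT _ yb))).
(* As v maps the finite set inv y into itself, it maps it onto itself. *)
have yv b : v b \in inv y -> b \in inv y.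
  move=> vby; have /eqP e : v @: inv y == inv y.
    rewrite eqEcard card_imset ?leqnn ?andbT; last exact: perm_inj.
    by apply/subsetP => _ /imsetP[c cy ->]; exact: vy.
  by move: vby; rewrite -{1}e => /imsetP[c cy /perm_inj->].
(* No stable root is an inversion of y. *)
have y_st b : b \in st -> y b \in pos -> b \in pos.
  move=> bS ybP; apply: contraT => bN.
  have : root_opp b \in inv y.
    by rewrite inv_setE // linear_perm_opp // !pos_opp // bN ybP.
  by move/(subsetP yT)/T_st; rewrite st_opp bS.
move=> b0 b1 b c0 c1 b0y b1S c00 c10 e.
have bT := satT _ _ _ _ _ (subsetP yT _ b0y) b1S c00 c10 e.
have bP := subsetP Tpos _ bT.
have [yb1|yb1] := boolP (y b1 \in pos); last first.
  rewrite inv_setE // bP -in_setC.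
  apply: (nonpos_convex hD _ _ c00 c10 (linear_perm_comb ly e)).
    by move: b0y; rewrite inv_setE // in_setC => /andP[].
  by rewrite in_setC.
have b1v : b1 \in inv v by rewrite inv_v b1S (y_st b1).
have vb1 : v b1 \notin pos by move: b1v; rewrite inv_setE // => /andP[].
have vbP : v b \in pos by apply: (subsetP Tpos); exact: refl_saturated.
apply: yv; rewrite inv_setE // vbP -in_setC.
apply: (nonpos_convex hD _ _ c00 c10
          (linear_perm_comb ly (linear_perm_comb lv e))).
  by move: (vy _ b0y); rewrite inv_setE // in_setC => /andP[].
by rewrite in_setC; apply: contra vb1; apply: y_st; rewrite v_st.
Qed.

(** One step of the recursion adds to the inversions of w the preimages under w
    of the largest inversion set in a saturated set, and w preserves the stable
    roots. *)
Lemma saturated_garside d : saturated (inv (garside (nseq d w))) /\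
  inv (garside (nseq d w)) \subset pos :\: st.
Proof.
elim: d => [|d [satd subd]].
  by rewrite /= inv_set1 // sub0set; split=> // b0 b1 b c0 c1; rewrite in_set0.
rewrite garside_nseqS; set z := garside _ in satd subd *.
have zW : z \in W by exact: garside_nseq_in.
have [y [ey yW -> yz red]] := stepP zW wW.
have ly := Wlin yW; have lw := Wlin wW; have lw' := linear_perm_inv lw.
have saty : saturated (inv y).
  rewrite ey; apply: saturated_largest; first exact: avoid_convex.
    exact: subset_trans (subsetDl _ _) subd.
  move=> b0 b1 b c0 c1 /setDP[b0z b0w] b1S c00 c10 e.
  have bz := satd _ _ _ _ _ b0z b1S c00 c10 e; rewrite in_setD bz andbT.
  have w'_st c : ((w^-1)%g c \in st) = (c \in st) by rewrite -w_st permKV.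
  have := subsetP subd _ b0z; rewrite in_setD => /andP[b0S b0P].
  have := @nonstable_add ((w^-1)%g b0) ((w^-1)%g b1) ((w^-1)%g b) c0 c1.
  rewrite !in_setD !w'_st b0S b1S; move: b0w; rewrite !inv_setE // b0P /= negbK.
  move=> -> /(_ isT isT c00 (linear_perm_comb lw' e))/andP[_ ->].
  by rewrite andbF.
have sub1 : inv (wmul y w) \subset pos :\: st.
  apply/subsetP => b; rewrite inv_set_reduced //.
  case/orP=> [/(subsetP inv_nonstable)//|wby].
  have := subsetP subd _ (subsetP yz _ wby).
  rewrite !in_setD w_st => /andP[-> _].
  by move/(reducedP hD ly lw): red => /(_ _ wby); rewrite permK.
split=> // b0 b1 b c0 c1; rewrite !inv_set_reduced //.
move=> /orP[b0w|b0y] b1S c00 c10 e.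
  by rewrite (saturated_inv b0w b1S c00 c10 e).
apply/orP; right; apply: (saty _ (w b1) _ c0 c1 b0y) => //.
  by rewrite w_st.
exact: linear_perm_comb e.
Qed.

Lemma saturated_convexU (S L : {set rootT Phi}) :
  root_convex S -> saturated S -> root_convex L -> L \subset st ->
  root_convex (S :|: L).
Proof.
move=> cS satS cL Lst b0 b1 b c0 c1 /setUP[b0S|b0L] /setUP[b1S|b1L] c00 c10 e.
- by rewrite in_setU (cS b0 b1 b c0 c1).
- by rewrite in_setU (satS b0 b1 b c0 c1) // (subsetP Lst).
- by rewrite in_setU (satS b1 b0 b c1 c0) // ?(subsetP Lst) // addrC.
- by rewrite in_setU (cL b0 b1 b c0 c1) ?orbT.
Qed.

Lemma saturated_crossing (N L : {set rootT Phi}) :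
  stable Delta w = st ->
  root_convex N -> saturated N -> N \subset pos :\: st -> inv w \subset N ->
  (forall b, b \in N -> b \notin inv w -> w b \in N) ->
  root_convex L -> L \subset st -> w @: L = L -> opp_set L = L ->
  crossing_pair Delta w N L.
Proof.
move=> stE cN satN Nsub wN stepN cL Lst wL oL; split.
  split; rewrite ?stE //.
  by apply/subsetP => _ /imsetP[b /setDP[bN bw] ->]; exact: stepN.
split=> //.
- apply/subsetP => b /(subsetP Lst) bS; rewrite in_setC; apply/negP.
  by move/(subsetP Nsub); rewrite in_setD bS.
- apply: saturated_convexU => //; last exact: saturated_inv.
  exact: inv_set_convex (Wlin wW).
- exact: saturated_convexU.
Qed.

(** With DG(b_w^(d+1)) = y w, a root b of this kind is sent by w to an inversion
    of y, hence of DG(b_w^d). *)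
Lemma garside_step d b : b \in inv (garside (nseq d.+1 w)) -> b \notin inv w ->
  w b \in inv (garside (nseq d.+1 w)).
Proof.
move=> bN bw; apply: (subsetP (garside_nseq_mono d wW)).
move: bN; rewrite garside_nseqS.
have [y [_ yW -> yz red]] := stepP (garside_nseq_in d wW) wW.
have ly := Wlin yW; have lw := Wlin wW.
by rewrite inv_set_reduced // (negPf bw) => /(subsetP yz).
Qed.

End Convex.
End WeakOrder.

(** * The two crossing pairs *)

(** The iterates of w b are those of b, shifted by one; the converse holds since
    w is a permutation of a finite set. *)
Lemma stable_perm (R : realType) (n : nat) (Phi : rootSystem R n)
    (Delta : {set rootT Phi}) (w : {perm rootT Phi}) b :
  (w b \in stable Delta w) = (b \in stable Delta w).
Proof.
have sub c : c \in stable Delta w -> w c \in stable Delta w.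
  rewrite !inE => /asboolP H; apply/asboolP.
  have e1 i : (w ^+ i)%g (w c) = (w ^+ i.+1)%g c by rewrite expgS permM.
  have e2 i : (w ^- i.+1)%g (w c) = (w ^- i)%g c.
    by rewrite -permM expgSr invMg mulKVg.
  have e3 : (w ^- 0)%g (w c) = (w ^+ 1)%g c by rewrite expg0 invg1 perm1 expg1.
  case: H => H; [left|right] => -[|i]; rewrite ?e2 ?e3 e1.
  - by have [] := H 1%N.
  - by have [+ _] := H i.+2; have [_] := H i.
  - by have [] := H 1%N.
  - by have [+ _] := H i.+2; have [_] := H i.
apply/idP/idP; last exact: sub.
have /eqP e : w @: stable Delta w == stable Delta w.
  rewrite eqEcard card_imset ?leqnn ?andbT; last exact: perm_inj.
  by apply/subsetP => _ /imsetP[c cs ->]; exact: sub.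
by rewrite -{1}e => /imsetP[c cs /perm_inj->].
Qed.

Lemma stable_pos (R : realType) (n : nat) (Phi : rootSystem R n)
    (Delta : {set rootT Phi}) (hD : is_base Delta) (w : {perm rootT Phi}) b :
  b \in stable Delta w -> (w b \in pos Delta) = (b \in pos Delta).
Proof.
rewrite inE => /asboolP[] H; case: (H 0%N) => + _; case: (H 1%N) => + _;
  rewrite expg0 expg1 perm1.
  by move=> -> ->.
by rewrite !neg_pos // => /negPf-> /negPf->.
Qed.

Theorem mainTheorem4 (R : realType) (n : nat) (Phi : rootSystem R n)
    (Delta : {set rootT Phi}) (hDelta : is_base Delta)
    (Omega : {group {perm rootT Phi}}) (hOmega : twist_group Delta Omega)
    (w : {perm rootT Phi}) (hw : w \in twisted_weyl Omega)
    (hconv : convex_elt Delta w)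
    (L : {set rootT Phi}) (hL : root_convex L) (hLst : L \subset stable Delta w)
    (hwL : w @: L = L) (hoppL : opp_set L = L) :
  crossing_pair Delta w (pos Delta :\: stable Delta w) L /\
  forall d : nat, (1 <= d)%N ->
    crossing_pair Delta w
      (inv_set Delta (DG Delta (twisted_weyl Omega) (nseq d w))) L.
Proof.
have Wlin p : p \in twisted_weyl Omega -> linear_perm p.
  exact: twisted_weyl_linear hOmega.
have Wrefl a : root_refl a \in twisted_weyl Omega.
  exact: (subsetP (joing_subl _ _)) (root_refl_weyl a).
have [J JD stE] := hconv.
have w_st b := stable_perm Delta w b.
have w_pos b := @stable_pos _ _ _ _ hDelta w b.
rewrite stE in w_st w_pos hLst *.
have cross := saturated_crossing hDelta Wlin JD hw w_st w_pos stE _ _ _ _ _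
  hL hLst hwL hoppL.
split.
  apply: cross => //.
  - exact: nonstable_convex.
  - exact: saturated_nonstable.
  - exact: inv_nonstable.
  - by move=> b bN bw; exact: w_nonstable.
case=> // d _.
have wsW : all (fun p : {perm rootT Phi} => p \in twisted_weyl Omega)
    (nseq d.+1 w) by apply/allP => p /nseqP[->].
rewrite (inv_DG hDelta Wlin Wrefl _ wsW) //.
have [satd subd] := saturated_garside hDelta Wlin Wrefl JD hw w_st w_pos d.+1.
have gW := garside_nseq_in hDelta Wlin Wrefl d.+1 hw.
apply: cross => //.
- exact/inv_set_convex/Wlin.
- rewrite garside_nseqS step_ge //; exact: garside_nseq_in.
- by move=> b; exact: garside_step.
Qed.
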